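(* Let $n\ge 1$ be an integer, let $a<b$, and suppose that $f:(a,b)\to\mathbb{R}$ is $n$ times differentiable and that $|f^{(n)}(x)|\ge\lambda>0$ for all $x\in(a,b)$. Then for every $\alpha>0$, $$ |\{x\in(a,b): |f(x)|\le\alpha\}|\le C_n\left(\alpha/\lambda\right)^{1/n}, $$ where $C_n=(n!\,2^{2n-1})^{1/n}$.
   Context: For a set $E\subset\mathbb{R}$, $|E|$ denotes its Lebesgue measure. $f^{(n)}$ denotes the $n$th derivative, which is not assumed to be continuous. *)

(* Defs.v *)
From mathcomp Require Import all_boot all_order all_algebra.
From mathcomp Require Import all_classical all_reals all_analysis.

Set Implicit Arguments.
Unset Strict Implicit.
Unset Printing Implicit Defensive.

Import Order.TTheory GRing.Theory Num.Theory.
Import numFieldNormedType.Exports.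

Local Open Scope classical_set_scope.
Local Open Scope ring_scope.

(* Functions on (a, b) are represented by total functions R -> R.  On an open
   set A this loses nothing: the derivatives of f at a point of A depend only
   on the values of f near that point, and only derivatives at points of A are
   assumed to exist.  The n-th derivative need not be continuous. *)
Definition times_derivable_on (R : realType) (n : nat) (f : R -> R)
    (A : set R) : Prop :=
  forall k : nat, (k < n)%N -> forall x : R, A x -> derivable (derive1n k f) x 1.

Definition sublevel_const (R : realType) (n : nat) : R :=
  ((n`!)%:R * 2 ^+ (2 * n - 1)) `^ (n%:R^-1).

(* Main.v *)
(* Suppose the sublevel set E has measure greater than M.  Walking through E from
   left to right one finds n+1 points of E whose mutual distances are at least
   those of the n+1 extremal points of the Chebyshev polynomial T_n, transported
   from [-1, 1] to an interval of length M.  By Rolle's theorem the divided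
   difference of f at these points is f^(n)(t) / n! for some t, while its absolute
   value is at most alpha times the sum of the inverse Lagrange weights.  For the
   Chebyshev extremal points this sum is exactly 2^(2n-1) / M^n, which gives
   lambda M^n <= n! 2^(2n-1) alpha. *)
Require Import Defs.
From mathcomp Require Import all_boot all_order all_algebra.
From mathcomp Require Import all_classical all_reals all_analysis.
From mathcomp Require Import measurable_realfun ring lra.

Import Order.TTheory GRing.Theory Num.Theory.
Import numFieldNormedType.Exports.

Local Open Scope classical_set_scope.
Local Open Scope ring_scope.

(** * Lagrange interpolation and the leading coefficient of the interpolant *)

Section Lagrange.
Context (F : fieldType) (n : nat) (x : 'I_n.+1 -> F).
Hypothesis x_inj : injective x.

Let node i : {poly F} := \prod_(k | k != i) ('X - (x k)%:P).
Let weight i : F := \prod_(k | k != i) (x i - x k).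

Let size_node i : size (node i) = n.+1.
Proof.
by rewrite /node -big_filter size_prod_XsubC size_filter -sum1_count sum1_card
  cardC1 card_ord.
Qed.

Let lead_node i : (node i)`_n = 1.
Proof.
have /monicP := monic_prod_XsubC (index_enum 'I_n.+1) (fun k => k != i) x.
by rewrite /lead_coef -/(node i) size_node.
Qed.

Let weight_neq0 i : weight i != 0.
Proof.
apply/prodf_neq0 => k ki; rewrite subr_eq0; apply: contra ki.
by move/eqP/x_inj ->.
Qed.

Let horner_node i j : (node i).[x j] = if i == j then weight i else 0.
Proof.
rewrite /node horner_prod; have [->|ij] := eqVneq i j.
  by apply: eq_bigr => k _; rewrite !hornerE.
by rewrite (bigD1 j) /= 1?eq_sym// !hornerE subrr mul0r.
Qed.

(** Each [node i] is monic of degree [n], so the top coefficient of the Lagrange form is the sum of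
    its scalars: the divided difference of [y]. *)
Lemma interpolation (y : 'I_n.+1 -> F) : exists p : {poly F},
  [/\ (size p <= n.+1)%N, forall i, p.[x i] = y i
    & p`_n = \sum_i y i / \prod_(k | k != i) (x i - x k)].
Proof.
exists (\sum_i (y i / weight i) *: node i); split.
- apply: leq_trans (size_sum _ _ _) _; apply/bigmax_leqP => i _.
  by apply: leq_trans (size_scale_leq _ _) _; rewrite size_node.
- move=> j; rewrite horner_sum (bigD1 j)//= hornerZ horner_node eqxx divfK//.
  by rewrite big1 ?addr0// => i ij; rewrite hornerZ horner_node (negbTE ij) mulr0.
- by rewrite coef_sum; apply: eq_bigr => i _; rewrite coefZ lead_node mulr1.
Qed.

(** The difference between [p] and its interpolant has degree at most [n] and [n.+1] distinct roots,
    hence is zero. *)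
Lemma coef_lagrange (p : {poly F}) : (size p <= n.+1)%N ->
  p`_n = \sum_i p.[x i] / \prod_(k | k != i) (x i - x k).
Proof.
move=> sp; have [q [sq qx <-]] := interpolation (fun i => p.[x i]).
suff -> : p = q by [].
apply/eqP; rewrite -subr_eq0; apply/eqP.
apply: (@roots_geq_poly_eq0 _ _ (map x (enum 'I_n.+1))).
- by apply/allP => _ /mapP[i _ ->]; rewrite rootE !hornerE qx subrr.
- by rewrite map_inj_uniq ?enum_uniq.
- rewrite size_map size_enum_ord; apply: leq_trans (size_polyD _ _) _.
  by rewrite size_polyN geq_max sp.
Qed.

End Lagrange.

(** * Chebyshev polynomials and their extremal points *)

Section Chebyshev.
Context (R : realType).

Fixpoint chebyshev (n : nat) : {poly R} :=
  match n with
  | 0 => 1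
  | m.+1 => match m with
            | 0 => 'X
            | k.+1 => 'X * chebyshev m *+ 2 - chebyshev k
            end
  end.

Lemma chebyshevSS n :
  chebyshev n.+2 = 'X * chebyshev n.+1 *+ 2 - chebyshev n.
Proof. by []. Qed.

Lemma size_chebyshev n : (size (chebyshev n) <= n.+1)%N.
Proof.
suff : (size (chebyshev n) <= n.+1)%N /\ (size (chebyshev n.+1) <= n.+2)%N.
  by case.
elim: n => [|n [IH1 IH2]]; first by rewrite /= size_poly1 size_polyX.
split=> //; rewrite chebyshevSS; apply: leq_trans (size_polyD _ _) _.
rewrite geq_max size_polyN (leq_trans IH1 (leqW (leqnSn _))) andbT.
rewrite -scaler_nat; apply: leq_trans (size_scale_leq _ _) _.
by apply: leq_trans (size_polyMleq _ _) _; rewrite size_polyX.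
Qed.

(** The recurrence doubles the leading coefficient from degree 1 on; degrees 0 and 1 both have
    leading coefficient 1, hence the shifted index. *)
Lemma coef_chebyshev n : (chebyshev n.+1)`_n.+1 = 2 ^+ n.
Proof.
elim: n => [|n IH]; first by rewrite /= coefX.
rewrite chebyshevSS coefB coefMn coefXM /= IH.
by rewrite [X in _ - X]nth_default ?size_chebyshev ?subr0 1?exprS ?mulr_natl//
  (leq_trans (size_chebyshev n)).
Qed.

Lemma chebyshev_cos n (t : R) : (chebyshev n).[cos t] = cos (n%:R * t).
Proof.
suff : (chebyshev n).[cos t] = cos (n%:R * t) /\
  (chebyshev n.+1).[cos t] = cos (n.+1%:R * t) by case.
elim: n => [|n [IH1 IH2]]; first by rewrite mul0r mul1r cos0 /= !hornerE.
split=> //; rewrite chebyshevSS !hornerE IH1 IH2.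
have -> : n.+2%:R * t = n.+1%:R * t + t by rewrite -[n.+2]addn1 natrD; ring.
have -> : n%:R * t = n.+1%:R * t - t by rewrite -[n.+1]addn1 natrD; ring.
by rewrite cosB cosD; ring.
Qed.

Lemma cos_natpi (i : nat) : cos (i%:R * pi) = (-1) ^+ i :> R.
Proof.
elim: i => [|i IH]; first by rewrite mul0r cos0.
by rewrite -addn1 natrD mulrDl mul1r cosDpi IH addn1 exprS mulN1r.
Qed.

(** The extremal points of T_n on [-1, 1], listed from right to left. *)
Definition chebyshev_node (n i : nat) : R := cos (i%:R * pi / n%:R).

Lemma chebyshev_node0 n : chebyshev_node n 0 = 1.
Proof. by rewrite /chebyshev_node !mul0r cos0. Qed.

Lemma chebyshev_nodenn n : (0 < n)%N -> chebyshev_node n n = -1.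
Proof.
by move=> n0; rewrite /chebyshev_node mulrAC divff ?mul1r ?cospi// pnatr_eq0 -lt0n.
Qed.

Lemma chebyshev_node_lt n i k : (0 < n)%N -> (i < k <= n)%N ->
  chebyshev_node n k < chebyshev_node n i.
Proof.
move=> n0 /andP[ik kn]; have n0R : 0 < n%:R :> R by rewrite ltr0n.
have node_itv j : (j <= n)%N -> j%:R * pi / n%:R \in `[0 : R, pi].
  move=> jn; rewrite in_itv/= divr_ge0 ?mulr_ge0 ?pi_ge0 ?ler0n//=.
  by rewrite ler_pdivrMr// mulrC ler_wpM2l ?pi_ge0// ler_nat.
rewrite /chebyshev_node ltr_cos ?node_itv// 1?(leq_trans (ltnW ik))//.
by rewrite ltr_pM2r ?invr_gt0// ltr_pM2r ?pi_gt0// ltr_nat.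
Qed.

(* T_n alternates between 1 and -1 at its n+1 extremal points, exactly as the
   sign of the Lagrange weights does, so the sum of the absolute values of the
   inverse weights is the leading coefficient of T_n. *)
Lemma chebyshev_weights n : (0 < n)%N ->
  \sum_(i < n.+1) (\prod_(k < n.+1 | k != i)
    `|chebyshev_node n i - chebyshev_node n k|)^-1 = 2 ^+ n.-1.
Proof.
case: n => [//|n] _; set c := chebyshev_node n.+1.
have c_lt i k : (i < k <= n.+1)%N -> c k < c i by exact: chebyshev_node_lt.
have c_inj : injective (fun i : 'I_n.+2 => c i).
  move=> i k /eqP; case: (ltngtP i k) => [ik|ki|/val_inj->//].
  - by rewrite gt_eqF// c_lt// ik -ltnS ltn_ord.
  - by rewrite lt_eqF// c_lt// ki -ltnS ltn_ord.
(* The power of 2 is read as the leading coefficient of T_(n+1), then expanded by interpolating this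
   polynomial at its own extremal points. *)
rewrite /= -coef_chebyshev (coef_lagrange _ _ _ c_inj) ?size_chebyshev//.
apply: eq_bigr => i _.
have -> : (chebyshev n.+1).[c i] = (-1) ^+ i.
  rewrite chebyshev_cos mulrC divfK ?pnatr_eq0//.
  exact: cos_natpi.
have -> : \prod_(k < n.+2 | k != i) (c i - c k) =
    (-1) ^+ i * \prod_(k < n.+2 | k != i) `|c i - c k|.
  (* The nodes decrease, so [c i - c k] is negative exactly when [k < i]: the product has [i]
     negative factors. *)
  have count_lt : (\sum_(k < n.+2 | k != i) (k < i) = i)%N.
    rewrite [RHS](_ : _ = \sum_(k < i) 1)%N; last by rewrite sum1_card card_ord.
    rewrite (big_ord_widen _ (fun=> 1%N) (ltnW (ltn_ord i))) big_mkcond.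
    rewrite [RHS]big_mkcond; apply: eq_bigr => k _.
    by case: eqVneq => [->|]; rewrite /= ?ltnn//; case: ltnP.
  rewrite -[in X in X * _]count_lt expr_sum -big_split; apply: eq_bigr => k ki /=.
  case: (ltngtP k i) => [lt_ki|lt_ik|/val_inj eq_ki]; last by rewrite eq_ki eqxx in ki.
  - rewrite ltr0_norm ?mulN1r ?opprK// subr_lt0 c_lt//.
    by rewrite lt_ki -ltnS ltn_ord.
  - by rewrite gtr0_norm ?mul1r// subr_gt0 c_lt// lt_ik -ltnS ltn_ord.
by rewrite invfM mulrA divff ?mul1r// signr_eq0.
Qed.

End Chebyshev.

(** * Iterated Rolle theorem *)

Section Rolle.
Context (R : realType) (a b : R).

(** Between consecutive zeros of [g 0] lies a zero of [g 1]; induction then applies to the shifted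
    family, with one point fewer. The last function [g n] may be discontinuous. *)
Lemma iterated_Rolle n (g : nat -> R -> R) (x : nat -> R) :
  (forall k t, (k < n)%N -> t \in `]a, b[ -> is_derive t 1 (g k) (g k.+1 t)) ->
  (forall i, (i <= n)%N -> x i \in `]a, b[) ->
  (forall i, (i < n)%N -> x i < x i.+1) ->
  (forall i, (i <= n)%N -> g 0%N (x i) = 0) ->
  exists2 t : R, t \in `]a, b[ & g n t = 0.
Proof.
elim: n g x => [|n IH] g x dg xab x_lt gx0; first by exists (x 0%N); auto.
(* A point is chosen for every natural number; indices beyond [n] get the placeholder 0. *)
have /choice[y y_def] (i : nat) : exists y, (i <= n)%N ->
    (y \in `]x i, x i.+1[) /\ g 1%N y = 0.
  have [i_n|] := leqP i n; last by exists 0.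
  have sub t : t \in `[x i, x i.+1] -> t \in `]a, b[.
    have := xab i (leqW i_n); have := xab i.+1 i_n.
    rewrite !in_itv/= => /andP[_ xb] /andP[ax _] /andP[xt tx].
    by rewrite (lt_le_trans ax xt) (le_lt_trans tx xb).
  have sub' t : t \in `]x i, x i.+1[ -> t \in `]a, b[.
    by move=> txx; apply: sub; exact: subset_itv_oo_cc.
  have [|||t txx gt0] := @Rolle _ (g 0%N) _ _ (x_lt i i_n).
  - by move=> t /sub' /(dg 0%N) [].
  - by apply: derivable_within_continuous => t /sub /(dg 0%N) [].
  - by rewrite !gx0// leqW.
  exists t => _; split=> //.
  have [_ <-] := dg 0%N t isT (sub' _ txx).
  by have [_ ->] := gt0.
apply: (IH (fun k => g k.+1) y) => [k t kn|i i_n|i i_n|i i_n].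
- exact: dg.
- have [yx _] := y_def i i_n; move: yx; rewrite !in_itv/= => /andP[xy yx].
  have := xab i (leqW i_n); have := xab i.+1 i_n.
  rewrite !in_itv/= => /andP[_ xb] /andP[ax _].
  by rewrite (lt_trans ax xy) (lt_trans yx xb).
- have [] := y_def i (ltnW i_n); rewrite in_itv/= => /andP[_ yx] _.
  have [] := y_def i.+1 i_n; rewrite in_itv/= => /andP[xy _] _.
  exact: lt_trans xy.
- by have [] := y_def i i_n.
Qed.

End Rolle.

(** * Separated points in a set of large measure *)

Section Chain.
Context (R : realType).
Local Notation mu := (@lebesgue_measure R).

(* Greedy choice: take a point of E within [e] of its infimum [m] and restart
   from the part of E beyond [m + e + d 0]; the discarded part of E has measure
   at most [e + d 0]. *)
Lemma separated_chain n (d : nat -> R) (E : set R) :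
  measurable E -> has_lbound E -> (forall i, 0 <= d i) ->
  ((\sum_(i < n) d i)%:E < mu E)%E ->
  exists x : nat -> R, (forall i, (i <= n)%N -> E (x i)) /\
    (forall i, (i < n)%N -> x i + d i <= x i.+1).
Proof.
elim: n d E => [|n IH] d E mE lbE d0 dE.
  have [E0|/set0P[t Et]] := eqVneq E set0; last by exists (fun=> t).
  by move: dE; rewrite E0 big_ord0 measure0 ltxx.
have E0 : E !=set0.
  apply/set0P/eqP => E0; move: dE; rewrite E0 measure0 lte_fin ltNge.
  by rewrite sumr_ge0.
(* The strict inequality leaves room for [e]: half the excess if [mu E] is finite, 1 if it is
   infinite. *)
have [e e0 de] : exists2 e : R, 0 < e & ((e + \sum_(i < n.+1) d i)%:E < mu E)%E.
  case: (mu E) (measure_ge0 mu E) dE => [r| |] //= _.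
    rewrite lte_fin => dr; exists ((r - \sum_(i < n.+1) d i) / 2); first lra.
    rewrite lte_fin; lra.
  by move=> _; exists 1; rewrite ?ltry.
have [x0 Ex0 x0e] := inf_adherent e0 (conj E0 lbE).
pose E' := E `&` `[inf E + e + d 0%N, +oo[.
pose I : set R := `[inf E, inf E + e + d 0%N[%classic.
have mI : measurable I by exact: measurable_itv.
have mE' : measurable E' by apply: measurableI.
have [|||x [Ex xd]] := IH (d \o succn) E' mE'.
- by have [l El] := lbE; exists l => t [/El].
- by move=> i; exact: d0.
- have sub : E `<=` E' `|` I.
    move=> t Et; have [h|h] := leP (inf E + e + d 0%N) t.
      by left; split=> //=; rewrite in_itv/= h.
    right; rewrite /I /= in_itv/= h andbT.
    exact: ge_inf.
  have : (mu E <= mu E' + (e + d 0%N)%:E)%E.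
    have mU : measurable (E' `|` I).
      exact: measurableU.
    apply: (@le_trans _ _ (mu (E' `|` I))).
      by apply: le_measure; rewrite ?inE.
    apply: (@le_trans _ _ (mu E' + mu I)%E).
      exact: measureU2.
    rewrite leeD2l// /I lebesgue_measure_itv/= lte_fin; case: ifP => _.
      by rewrite -EFinB lee_fin; lra.
    by rewrite lee_fin addr_ge0// ltW.
  move=> /(lt_le_trans de); rewrite big_ord_recl -lteBlDr//.
  rewrite -EFinB (_ : _ - _ = \sum_(i < n) d i.+1)//.
  by rewrite [X in _ + _ - X]addrC; lra.
exists (fun i => if i is j.+1 then x j else x0); split.
- by case=> [//|i] /Ex [].
- case=> [_|i /xd//]; have [_ /=] := Ex 0%N (leq0n n).
  rewrite in_itv/= andbT; lra.
Qed.

End Chain.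

(** * Divided differences and the sublevel set estimate *)

(** If [p] interpolates [f] at the points, [f - p] has [n.+1] zeros, so its n-th derivative vanishes
    at some [t]; that of [p] is constant, n! times its top coefficient. *)
Lemma divided_difference_MVT (R : realType) (a b : R) n (f : R -> R)
    (x : nat -> R) :
  times_derivable_on n f `]a, b[ ->
  (forall i, (i <= n)%N -> x i \in `]a, b[) ->
  (forall i k, (i < k <= n)%N -> x i < x k) ->
  exists2 t : R, t \in `]a, b[ & derive1n n f t =
    n`!%:R * \sum_(i < n.+1) f (x i) / \prod_(k < n.+1 | k != i) (x i - x k).
Proof.
move=> df xab x_lt.
have x_inj : injective (fun i : 'I_n.+1 => x i).
  move=> i k /eqP; case: (ltngtP i k) => [ik|ki|/val_inj->//].
  - by rewrite lt_eqF// x_lt// ik -ltnS ltn_ord.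
  - by rewrite gt_eqF// x_lt// ki -ltnS ltn_ord.
have [p [sp px <-]] := interpolation _ _ _ x_inj (fun i => f (x i)).
have [k t kn tab|i i_n|i i_n|i i_n|t tab /eqP] := @iterated_Rolle _ a b n
  (fun k t => derive1n k f t - p^`(k).[t]) x.
- rewrite derive1nS derivnS derive1E.
  exact: is_deriveB (derivableP (df _ kn _ tab)) (is_derive_poly _ _).
- exact: xab.
- by rewrite x_lt// leqnn.
- by rewrite -ltnS in i_n; rewrite /= (px (Ordinal i_n)) subrr.
rewrite subr_eq0 => /eqP ft; exists t => //; rewrite ft.
have : (size p^`(n) <= 1)%N.
  apply/leq_sizeP => j j1; rewrite coef_derivn nth_default ?mul0rn//.
  by apply: leq_trans sp _; rewrite -addn1 leq_add2l.
by move=> /size1_polyC ->; rewrite hornerC coef_derivn addn0 ffactnn mulr_natl.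
Qed.

Lemma sublevel_chain_bound (R : realType) (a b : R) n (f : R -> R)
    (lambda alpha M : R) (x : nat -> R) : (0 < n)%N -> 0 < M ->
  times_derivable_on n f `]a, b[ ->
  (forall t, t \in `]a, b[ -> lambda <= `|derive1n n f t|) ->
  (forall i, (i <= n)%N -> (x i \in `]a, b[) /\ `|f (x i)| <= alpha) ->
  (forall i, (i < n)%N ->
    x i + M / 2 * (chebyshev_node R n i - chebyshev_node R n i.+1) <= x i.+1) ->
  lambda * M ^+ n <= n`!%:R * 2 ^+ (2 * n - 1) * alpha.
Proof.
move=> n0 M0 df fn xE xd; set c := chebyshev_node R n.
have M20 : 0 < M / 2 by rewrite divr_gt0.
have alpha0 : 0 <= alpha by have [_] := xE 0%N isT; exact: le_trans.
(* Consecutive gaps add up. The [x i] increase while the nodes decrease, whence the reversed order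
   of indices. *)
have x_sep i k : (i < k <= n)%N -> M / 2 * (c i - c k) <= x k - x i.
  elim: k => [//|k IH]; rewrite ltnS => /andP[ik kn].
  have := xd k kn; rewrite -/c; move: ik; rewrite leq_eqVlt => /predU1P[->|ik].
    lra.
  by have := IH; rewrite ik ltnW// => /(_ isT); lra.
have c_gap i k : (i < k <= n)%N -> 0 < M / 2 * (c i - c k).
  by move=> ik; rewrite mulr_gt0// subr_gt0 chebyshev_node_lt.
have x_dist (i k : 'I_n.+1) : k != i ->
    0 < M / 2 * `|c i - c k| <= `|x i - x k|.
  have sep (j l : 'I_n.+1) : (j < l)%N ->
      0 < M / 2 * `|c j - c l| <= `|x j - x l|.
    move=> jl; have {}jl : (j < l <= n)%N by rewrite jl -ltnS ltn_ord.
    have := c_gap _ _ jl; rewrite pmulr_rgt0// => cjl.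
    rewrite (gtr0_norm cjl) c_gap//= (le_trans (x_sep _ _ jl))//.
    by rewrite distrC ler_norm.
  case: (ltngtP k i) => [ki|ik|/val_inj->]; last by rewrite eqxx.
    by rewrite distrC (distrC (x i)) sep.
  by rewrite sep.
have [i i_n|i k ik|t tab ft] := divided_difference_MVT _ _ _ _ _ x df.
- by have [] := xE i i_n.
- by rewrite -subr_gt0 (lt_le_trans (c_gap i k ik)) ?x_sep.
(* Each weight has [n] factors, each at least [M / 2] times its Chebyshev counterpart: this yields
   [(2 / M) ^+ n], and [chebyshev_weights] yields [2 ^+ n.-1]. *)
have bound : `|\sum_(i < n.+1) f (x i) / \prod_(k < n.+1 | k != i) (x i - x k)|
    <= alpha * ((2 / M) ^+ n * 2 ^+ n.-1).
  apply: le_trans (ler_norm_sum _ _ _) _.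
  rewrite -(chebyshev_weights R n n0) !mulr_sumr; apply: ler_sum => i _.
  have wE : (2 / M) ^+ n * (\prod_(k < n.+1 | k != i) `|c i - c k|)^-1 =
      (\prod_(k < n.+1 | k != i) (M / 2 * `|c i - c k|))^-1.
    by rewrite big_split/= prodr_const cardC1 card_ord invfM -exprVn invf_div.
  rewrite -/c wE normrM normfV normr_prod ler_pM ?invr_ge0 ?prodr_ge0//.
    by have [] := xE i (ltn_ord i).
  rewrite lef_pV2 ?posrE.
  - by apply: ler_prod => k /x_dist /andP[/ltW -> ->].
  - by apply: prodr_gt0 => k /x_dist /andP[h1 h2]; exact: lt_le_trans h2.
  - by apply: prodr_gt0 => k /x_dist /andP[].
have := fn t tab; rewrite ft normrM ger0_norm// => lambda_le.
have {}lambda_le : lambda <= n`!%:R * (alpha * ((2 / M) ^+ n * 2 ^+ n.-1)).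
  by apply: le_trans lambda_le _; rewrite ler_wpM2l.
rewrite -ler_pdivlMr ?exprn_gt0//; apply: le_trans lambda_le _.
have -> : (2 * n - 1 = n + n.-1)%N by case: (n) n0 => // m _; rewrite mul2n -addnn subn1 addnS.
rewrite exprD expr_div_n le_eqVlt; apply/orP; left; apply/eqP; field.
by rewrite expf_neq0 ?gt_eqF.
Qed.

Theorem lemma1 (R : realType) (n : nat) (hn : (1 <= n)%N)
    (a b : R) (hab : a < b) (f : R -> R) (lambda : R)
    (hf : times_derivable_on n f `]a, b[)
    (hlambda : 0 < lambda)
    (hfn : forall x : R, x \in `]a, b[ -> lambda <= `|derive1n n f x|)
    (alpha : R) (halpha : 0 < alpha) :
  (lebesgue_measure [set x : R | ((x \in `]a, b[) /\ `|f x| <= alpha)%R]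
    <= ((sublevel_const R n * (alpha / lambda) `^ (n%:R^-1))%R)%:E)%E.
Proof.
set E := [set x : R | _]; set M0 := _ * _.
have lebE : has_lbound E.
  by exists a => t [+ _]; rewrite in_itv/= => /andP[/ltW].
(* As [n >= 1], [f] is differentiable, hence continuous on the interval, and [E] is the preimage of
   a closed interval. *)
have mE : measurable E.
  have -> : E = `]a, b[ `&` f @^-1` `[- alpha, alpha].
    by apply/seteqP; split=> t [tab ft]; split=> //; move: ft;
      rewrite /= in_itv/= ler_norml.
  have f_cont : {within `]a, b[, continuous f}.
    by apply: derivable_within_continuous => t; exact: (hf 0%N hn).
  have mab : measurable (`]a, b[%classic : set R) by exact: measurable_itv.
  have mf := subspace_continuous_measurable_fun mab f_cont.
  by apply: mf => //; exact: measurable_itv.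
have M0E : M0 ^+ n = n`!%:R * 2 ^+ (2 * n - 1) * (alpha / lambda).
  rewrite /M0 /sublevel_const -powRM ?divr_ge0 ?mulr_ge0 ?exprn_ge0 ?ltW//.
  rewrite -powR_mulrn ?powR_ge0// -powRrM mulVf ?pnatr_eq0 -?lt0n//.
  by rewrite powRr1// !mulr_ge0 ?invr_ge0 ?exprn_ge0 ?ltW.
have M0_ge0 : 0 <= M0 by rewrite mulr_ge0 ?powR_ge0.
rewrite leNgt; apply/negP => M0_lt.
(* A real [M] strictly above [M0] turns the non-strict chain bound on [M ^+ n] into a contradiction
   with the value of [M0 ^+ n]. *)
have [M M_gt M_lt] : exists2 M, M0 < M & (M%:E < lebesgue_measure E)%E.
  case: (lebesgue_measure E) M0_lt => [r| |] //=.
    rewrite lte_fin => M0r; exists ((M0 + r) / 2); first lra.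
    by rewrite lte_fin; lra.
  by exists (M0 + 1); rewrite ?ltry// ltrDl.
have M_gt0 : 0 < M by exact: le_lt_trans M_gt.
(* The gaps are set to 0 from index [n] on, since [separated_chain] asks for nonnegativity at every
   index and the nodes are only known to decrease up to [n]. *)
pose d i := if (i < n)%N
  then M / 2 * (chebyshev_node R n i - chebyshev_node R n i.+1) else 0.
have [i||x [xE xd]] := separated_chain _ n d E mE lebE.
- by rewrite /d; case: ifP => // i_n; rewrite mulr_ge0 ?divr_ge0 ?subr_ge0
    ?ltW ?chebyshev_node_lt// ltnSn.
(* The sum telescopes to [M / 2] times the distance 2 between the extreme nodes 1 and -1. *)
- suff -> : \sum_(i < n) d i = M by [].
  rewrite (eq_bigr (fun i : 'I_n =>
    - (M / 2) * (chebyshev_node R n i.+1 - chebyshev_node R n i))).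
    rewrite -mulr_sumr -(big_mkord xpredT
      (fun i => chebyshev_node R n i.+1 - chebyshev_node R n i)).
    by rewrite telescope_sumr// chebyshev_node0 chebyshev_nodenn//; field.
  by move=> i _; rewrite /d ltn_ord; ring.
have : lambda * M ^+ n <= n`!%:R * 2 ^+ (2 * n - 1) * alpha.
  apply: (sublevel_chain_bound _ _ _ _ _ _ _ _ x hn M_gt0 hf hfn xE) => i i_n.
  by have := xd i i_n; rewrite /d i_n.
apply/negP; rewrite -ltNge.
have : M0 ^+ n < M ^+ n by rewrite ltrXn2r// -lt0n.
by rewrite M0E mulrA ltr_pdivrMr// [X in _ < X]mulrC.
Qed.
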